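(* For every integer $\Delta\ge8$, \[ c_\Delta\ge\frac1\Delta-6\,\Delta^{-4/3}. \] Furthermore, \[ \lim_{\Delta\to\infty}\Delta\, c_\Delta=1 . \]
   Context: All graphs are finite, simple and undirected. $\Delta(G)$ denotes the maximum degree of $G$. A set $T\subseteq V(G)$ is an identifying vertex cover if $e\cap T\neq\emptyset$ for every $e\in E(G)$ and the sets $e\cap T$ ($e\in E(G)$) are pairwise distinct; $\tau_D(G)$ is the minimum cardinality of an identifying vertex cover of $G$. For a graph $G$ of order $n$, size $m$ and maximum degree $\Delta$, \[ \mathsf{B}_{\mathrm{HY}}(G)=\frac{\Delta(\Delta-1)n+2m}{\Delta^2+1}. \] For an integer $\Delta\ge4$, \[ c_\Delta=\sup\left\{\frac{\tau_D(G)-\mathsf{B}_{\mathrm{HY}}(G)}{|V(G)|}: G\text{ is connected and }\Delta(G)=\Delta\right\} \] (maximum degree exactly $\Delta$). *)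

(* Defs.v *)
From HB Require Import structures.
From mathcomp Require Import all_boot all_order all_algebra.
From mathcomp Require Import all_classical all_reals all_analysis.

Set Implicit Arguments.
Unset Strict Implicit.
Unset Printing Implicit Defensive.

Import Order.TTheory GRing.Theory Num.Theory.
Import numFieldNormedType.Exports.

Local Open Scope ring_scope.
Local Open Scope classical_set_scope.

Record graph := Graph {
  vertex :> finType;
  adj : rel vertex;
  adj_sym : symmetric adj;
  adj_irr : irreflexive adj }.

Definition edges (G : graph) : {set {set G}} :=
  [set [set x; y]%SET | x in [set: G]%SET, y in [set: G]%SET & adj x y]%SET.

Definition max_degree (G : graph) : nat :=
  (\max_(x : G) #|[set y | adj x y]%SET|)%N.

(* Only used with maximum degree at least 4, so the empty graph is irrelevant. *)
Definition connected_graph (G : graph) : Prop :=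
  forall x y : G, connect (@adj G) x y.

Definition identifying_vertex_cover (G : graph) (A : {set G}) : bool :=
  [forall e in edges G, e :&: A != finset.set0]%SET &&
  [forall e in edges G, forall f in edges G, (e != f) ==> (e :&: A != f :&: A)]%SET.

Lemma identifying_vertex_cover_setT (G : graph) :
  identifying_vertex_cover [set: G]%SET.
Proof.
apply/andP; split; last first.
  by apply/forall_inP => e _; apply/forall_inP => f _; rewrite !finset.setIT; apply/implyP.
apply/forall_inP => e /imset2P[x y _ _ ->]; rewrite finset.setIT.
by apply/set0Pn; exists x; rewrite !inE eqxx.
Qed.

(* A genuine minimum, by [identifying_vertex_cover_setT]. *)
Definition tau_D (G : graph) : nat :=
  #|[arg min_(A < [set: G]%SET | identifying_vertex_cover A) #|A|]|%N.

Definition B_HY (R : realType) (G : graph) : R :=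
  let D := (max_degree G)%:R in
  (D * (D - 1) * #|G|%:R + 2 * #|edges G|%:R) / (D ^+ 2 + 1).

Definition excess_set (R : realType) (Delta : nat) : set R :=
  [set r | exists G : graph,
     [/\ connected_graph G, max_degree G = Delta &
         r = ((tau_D G)%:R - B_HY R G) / #|G|%:R]].

Arguments excess_set : clear implicits.

(* [sup] takes the junk value 0 on empty or unbounded sets; for Delta >= 4 the
   set contains the value of the complete graph on Delta + 1 vertices and is
   bounded above by 1. *)
Definition c_sup (R : realType) (Delta : nat) : R := sup (excess_set R Delta).

(* Main.v *)
(* A set is an identifying vertex cover iff its complement is a 2-packing, that
   is, has pairwise distances at least 3. If P is a largest 2-packing and d is
   the average degree, then
     (tau_D(G) - B_HY(G)) / n = (Delta + 1 - d) / (Delta^2 + 1) - |P| / n,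
   so one wants d small and n large compared with |P|, while the maximum degree
   is Delta. Dropping d and P gives c_Delta <= (Delta + 1) / (Delta^2 + 1).
   For the lower bound take k groups of about Delta / 2 leaves, join both groups
   of every unordered pair to a hub, and join all hubs, padded to Delta vertices,
   to one centre. Two leaves share a hub and two hubs share the centre, so
   |P| <= 2, while d <= 2 k and n >= k Delta / 2. The choice
   k = ceil(Delta^(1/3)) costs 2 k / Delta^2 + 4 / (k Delta) <= 6 Delta^(-4/3). *)
Require Import Defs.
From HB Require Import structures.
From mathcomp Require Import all_boot all_order all_algebra.
From mathcomp Require Import all_classical all_reals all_analysis.
From mathcomp Require Import zify ring lra.

Set Implicit Arguments.
Unset Strict Implicit.
Unset Printing Implicit Defensive.

Import Order.TTheory GRing.Theory Num.Theory.
Import numFieldNormedType.Exports.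

Local Open Scope ring_scope.
Local Open Scope classical_set_scope.

(** * Vertices outside an identifying vertex cover *)

Lemma mem_edges (G : graph) (x y : G) : adj x y -> ([set x; y] \in edges G)%SET.
Proof. by move=> xy; apply/imset2P; exists x y; rewrite // !inE. Qed.

Section Packing.
Variables (G : graph) (A : {set G}).
Hypothesis Aivc : identifying_vertex_cover A.

Lemma ivc_nadj (x y : G) : x \notin A -> y \notin A -> ~~ adj x y.
Proof.
move=> xA yA; apply/negP => xy.
case/andP: Aivc => /forall_inP/(_ _ (mem_edges xy))/set0Pn[z].
by rewrite !inE => /andP[/orP[]/eqP->]; rewrite ?(negbTE xA) ?(negbTE yA).
Qed.

(** Otherwise the distinct edges [zx] and [zy] would have the same trace on [A], since [x] and [y]
    are both lost. *)
Lemma ivc_no_common_neighbour (x y z : G) : x != y ->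
  x \notin A -> y \notin A -> adj z x -> ~~ adj z y.
Proof.
move=> xy xA yA zx; apply/negP => zy.
case/andP: Aivc => _ /forall_inP/(_ _ (mem_edges zx))/forall_inP.
move=> /(_ _ (mem_edges zy))/implyP.
have neq : ([set z; x] != [set z; y])%SET.
  apply: contraNneq xy => E.
  have: (x \in [set z; y])%SET by rewrite -E !inE eqxx orbT.
  rewrite !inE => /orP[/eqP xz|//].
  by rewrite xz adj_irr in zx.
move=> /(_ neq)/eqP; apply; apply/finset.setP => w; rewrite !inE.
case: (eqVneq w x) => [->|_]; first by rewrite (negbTE xA) !andbF.
case: (eqVneq w y) => [->|_]; first by rewrite (negbTE yA) !andbF.
by [].
Qed.

End Packing.

(** * The hub graph and its parameters *)

Section Construction.
Variables (k s r : nat).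

(* The centre is [None]; its neighbours are one hub per ordered pair of groups
   and [r] padding vertices; the leaves form [k] groups of [s]. Only the hubs
   [(p, q)] with [p <= q] are joined to leaves, namely to those of the groups
   [p] and [q]; all other hubs serve as padding too. *)
Definition hub_vertex : finType :=
  option (('I_k * 'I_k + 'I_r) + ('I_k * 'I_s))%type.

Definition hub_arc (x y : hub_vertex) : bool :=
  match x, y with
  | None, Some (inl _) => true
  | Some (inl (inl (p, q))), Some (inr (a, _)) =>
      (p <= q)%N && ((a == p) || (a == q))
  | _, _ => false
  end.

Definition hub_adj : rel hub_vertex := fun x y => hub_arc x y || hub_arc y x.

Lemma hub_adj_sym : symmetric hub_adj.
Proof. by move=> x y; rewrite /hub_adj orbC. Qed.

Lemma hub_adj_irr : irreflexive hub_adj.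
Proof. by case=> [[[[p q]|i]|[a l]]|]. Qed.

Definition hub_graph : graph := Graph hub_adj_sym hub_adj_irr.

Definition leaf (al : 'I_k * 'I_s) : hub_graph := Some (inr al).

(** Sorting the indices makes [hub a b] and [hub b a] the same vertex. The diagonal hub [hub a a]
    serves group [a] alone. *)
Definition hub (a b : 'I_k) : hub_graph :=
  Some (inl (inl (if (a <= b)%N then (a, b) else (b, a)))).

Lemma adj_hub_leafl (a b : 'I_k) (l : 'I_s) : adj (hub a b) (leaf (a, l)).
Proof.
by rewrite /= /hub_adj /=; case: (leqP a b) => [->|/ltnW ->]; rewrite eqxx ?orbT.
Qed.

Lemma adj_hub_leafr (a b : 'I_k) (l : 'I_s) : adj (hub a b) (leaf (b, l)).
Proof.
by rewrite /= /hub_adj /=; case: (leqP a b) => [->|/ltnW ->]; rewrite eqxx ?orbT.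
Qed.

Lemma adj_leafP (a : 'I_k) (l : 'I_s) (y : hub_graph) :
  adj (leaf (a, l)) y -> exists b, y = hub a b.
Proof.
case: y => [[[[p q]|i]|[b l']]|] //=; rewrite /hub_adj /=.
case/andP=> pq /orP[]/eqP->; first by exists q; rewrite /hub pq.
exists p; rewrite /hub; case: leqP => // qp.
by have -> : p = q by apply/val_inj/eqP; rewrite /= eqn_leq pq.
Qed.

Lemma card_hub_graph : #|hub_graph| = (k * k + r + k * s).+1.
Proof. by rewrite card_option !card_sum !card_prod !card_ord. Qed.

Lemma hub_graph_connected : connected_graph hub_graph.
Proof.
have csym : connect_sym (@adj hub_graph).
  exact: (sym_connect_sym hub_adj_sym).
have to0 (x : hub_graph) : connect (@adj hub_graph) None x.
  case: x => [[h|[a l]]|]; [exact: connect1 | | exact: connect0].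
  apply: (connect_trans (y := hub a a)); first exact: connect1.
  by apply: connect1; exact: (adj_hub_leafl a a l).
by move=> x y; apply: connect_trans (to0 y); rewrite csym.
Qed.

Lemma card_edges_hub_graph : (#|edges hub_graph| <= k * k + r + k * s * k)%N.
Proof.
(* [E1] holds the edges at the centre, [E2] those at the leaves: a leaf of group [a] meets only the
   [k] hubs [hub a c]. *)
pose E1 := [set ([set None; Some (inl h)] : {set hub_graph})%SET
             | h : 'I_k * 'I_k + 'I_r]%SET.
pose E2 := [set ([set leaf x.1; hub x.1.1 x.2] : {set hub_graph})%SET
             | x : ('I_k * 'I_s) * 'I_k]%SET.
have arcE (x y : hub_graph) : hub_arc x y -> ([set x; y] \in E1 :|: E2)%SET.
  move=> xy; have axy : adj y x by rewrite /= /hub_adj xy orbT.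
  case: x y xy axy => [[[[p q]|i]|[a l]]|] [[h|[b l']]|] //= xy axy.
    have [c ->] := adj_leafP axy.
    rewrite !inE; apply/orP; right; apply/imsetP; exists ((b, l'), c) => //.
    by rewrite finset.setUC.
  by rewrite !inE; apply/orP; left; apply/imsetP; exists h.
have sub : (edges hub_graph \subset E1 :|: E2)%SET.
  apply/fintype.subsetP => e /imset2P[x y _ xy ->].
  have /orP[] : adj x y by move: xy; rewrite !inE.
    exact: arcE.
  by move=> yx; rewrite finset.setUC; exact: arcE.
apply: leq_trans (subset_leq_card sub) _.
apply: leq_trans (leq_card_setU _ _) _.
apply: leq_add; apply: leq_trans (leq_imset_card _ _) _.
  by rewrite card_sum card_prod !card_ord.
by rewrite !card_prod !card_ord.
Qed.

(** The centre attains the value; a hub has degree at most [2s + 1] and a leaf at most [k], which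
    the two hypotheses dominate. *)
Lemma max_degree_hub_graph : ((s.*2).+1 <= k * k + r)%N -> (k <= k * k + r)%N ->
  max_degree hub_graph = (k * k + r)%N.
Proof.
move=> hs hk; apply/eqP; rewrite eqn_leq; apply/andP; split; last first.
  apply: (leq_trans _ (leq_bigmax (None : hub_graph))).
  have inlI : injective (fun h => Some (inl h) : hub_graph) by move=> h h' [].
  rewrite -[X in (X <= _)%N](_ : #|{: 'I_k * 'I_k + 'I_r}| = _); last first.
    by rewrite card_sum card_prod !card_ord.
  rewrite -(card_imset _ inlI); apply: subset_leq_card.
  by apply/fintype.subsetP => y /imsetP[h _ ->]; rewrite inE.
apply/bigmax_leqP => x _; case: x => [[h|[a l]]|].
- pose nb (a : 'I_k) := [set leaf (a, l) | l : 'I_s]%SET.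
  have nbE (a : 'I_k) : (#|nb a| <= s)%N.
    by apply: leq_trans (leq_imset_card _ _) _; rewrite card_ord.
  have nb_leaf (a : 'I_k) l : leaf (a, l) \in nb a by apply/imsetP; exists l.
  case: h => [[p q]|i].
    apply: leq_trans hs; apply: (@leq_trans #|(None |: (nb p :|: nb q))%SET|).
      apply: subset_leq_card; apply/fintype.subsetP => y; rewrite !inE.
      case: y => [[[[? ?]|?]|[a l]]|] //=; rewrite /hub_adj /= ?orbF ?andbF //.
      by case/andP=> _ /orP[]/eqP->; rewrite nb_leaf ?orbT.
    rewrite cardsU1 -add1n; apply: leq_add; first exact: leq_b1.
    by apply: leq_trans (leq_card_setU _ _) _; rewrite -addnn leq_add.
  apply: (@leq_trans 1); last exact: leq_trans hs.
  rewrite -(cards1 (None : hub_graph)); apply: subset_leq_card.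
  apply/fintype.subsetP => y; rewrite !inE.
  by case: y => [[[[? ?]|?]|[a l]]|].
- apply: leq_trans hk; rewrite -[X in (_ <= X)%N]card_ord.
  rewrite -cardsT; apply: leq_trans (leq_imset_card (hub a) _).
  apply: subset_leq_card; apply/fintype.subsetP => y; rewrite inE => ay.
  by have [b ->] := adj_leafP ay; apply: imset_f; rewrite inE.
- have -> : (k * k + r = #|{: 'I_k * 'I_k + 'I_r}|)%N.
    by rewrite card_sum card_prod !card_ord.
  rewrite -cardsT.
  apply: leq_trans (leq_imset_card (fun h => Some (inl h) : hub_graph) _).
  apply: subset_leq_card; apply/fintype.subsetP => y; rewrite inE.
  case: y => [[h|[a l]]|] //= _; by apply: imset_f; rewrite inE.
Qed.

Lemma tau_D_hub_graph : (#|hub_graph| <= tau_D hub_graph + 2)%N.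
Proof.
rewrite /tau_D; case: arg_minnP => [|A Aivc _].
  exact: identifying_vertex_cover_setT.
rewrite -(cardsC A) leq_add2l.
pose is_leaf (x : hub_graph) := if x is Some (inr _) then true else false.
(* The complement of [A] has at most one leaf and at most one other vertex: leaves share a hub, and
   the remaining vertices are the centre and its neighbours. *)
suff inj : {in (~: A)%SET &, injective is_leaf}.
  by rewrite -(card_in_imset inj) -card_bool max_card.
move=> x y; rewrite !inE /is_leaf => xA yA xy; apply/eqP; apply: contraTT isT => neq.
have na := ivc_nadj Aivc xA yA.
have nc z := ivc_no_common_neighbour (z := z) Aivc neq xA yA.
case: x y neq na nc xy {xA yA} => [[h|[a l]]|] [[h'|[b l']]|] //= neq na nc _.
- by have := nc None isT.
- by move: na; rewrite /hub_adj orbT.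
- have /negP[] := nc (hub a b) (adj_hub_leafl a b l).
  exact: adj_hub_leafr.
Qed.

End Construction.

(** * Estimates of [c_sup] and the limit *)

Section Bounds.
Variable R : realType.

Lemma excess_set_ub (Delta : nat) :
  ubound (excess_set R Delta) ((Delta%:R + 1) / (Delta%:R ^+ 2 + 1)).
Proof.
move=> _ [G [_ mG ->]]; rewrite /B_HY mG.
set D : R := Delta%:R; set n : R := #|G|%:R; set m : R := #|edges G|%:R.
have D0 : 0 <= D by rewrite /D.
have m0 : 0 <= m by rewrite /m.
have DD : 0 < D ^+ 2 + 1 by nra.
(* The empty graph is vacuously connected; its quotient by 0 has the value 0. *)
have [n0|n0] := eqVneq n 0.
  by rewrite n0 invr0 mulr0 divr_ge0 //; lra.
have n_gt0 : 0 < n by rewrite lt_def n0 /n ler0n.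
have tn : (tau_D G)%:R <= n by rewrite /n ler_nat max_card.
rewrite ler_pdivrMr // lerBlDr -mulrAC -mulrDl ler_pdivlMr //.
nra.
Qed.

Lemma excess_ge (G : graph) (Delta k : nat) : (0 < Delta)%N ->
  connected_graph G -> max_degree G = Delta ->
  (0 < #|G|)%N -> (#|G| <= tau_D G + 2)%N -> (#|edges G| <= k * #|G|)%N ->
  1 / Delta%:R - 2 * k%:R / Delta%:R ^+ 2 - 2 / #|G|%:R <= c_sup R Delta.
Proof.
move=> D0 cG mG; rewrite -(ltr0n R) -(ler_nat R) -(ler_nat R) natrD natrM => n0 tG eG.
apply: (@le_trans _ _ (((tau_D G)%:R - B_HY R G) / #|G|%:R)); last first.
  apply: ub_le_sup; last by exists G.
  by eexists; exact: excess_set_ub.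
rewrite /B_HY mG; rewrite -(ler_nat R) in D0.
move: D0 n0 tG eG; set D : R := Delta%:R; set n : R := #|G|%:R.
set m : R := #|edges G|%:R; set t : R := (tau_D G)%:R => D0 n0 tG eG.
have k0 : 0 <= k%:R :> R by [].
move: k0 eG; set K : R := k%:R => k0 eG.
have DD : 0 < D ^+ 2 + 1 by nra.
have D_gt0 : 0 < D by lra.
(* Insert [t >= n - 2] and [m <= K * n]. Then [D >= 1] gives [(D + 1) / (D ^+ 2 + 1) >= 1 / D]. *)
apply: (@le_trans _ _ ((n - 2 - (D * (D - 1) * n + 2 * (K * n)) / (D ^+ 2 + 1)) / n)).
  have -> : (n - 2 - (D * (D - 1) * n + 2 * (K * n)) / (D ^+ 2 + 1)) / n
     = (D + 1) / (D ^+ 2 + 1) - 2 * K / (D ^+ 2 + 1) - 2 / n.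
    by field; rewrite !gt_eqF.
  rewrite lerD2r; apply: lerB.
    by rewrite ler_pdivlMr // mulrAC ler_pdivrMr //; nra.
  apply: ler_wpM2l; first by nra.
  by rewrite lef_pV2 ?posrE ?exprn_gt0 //; lra.
rewrite ler_pM2r ?invr_gt0 //; apply: lerB; first by lra.
by rewrite ler_pM2r ?invr_gt0 //; nra.
Qed.

Lemma c_sup_ge_cube_root (Delta k : nat) : (8 <= Delta)%N ->
  (k.-1 ^ 3 < Delta <= k ^ 3)%N ->
  1 / Delta%:R - 2 * k%:R / Delta%:R ^+ 2 - 4 / (k%:R * Delta%:R) <= c_sup R Delta.
Proof.
move=> D8 /andP[lo hi].
have k2 : (2 <= k)%N by case: k hi {lo} => [|[|k]] //; rewrite ?exp1n; lia.
(* For [k = 2] this is [8 <= Delta]; for [k >= 3], [k^2 <= (k - 1)^3 + 1 <= Delta], with equality in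
   the first step at [k = 3]. *)
have kk : (k * k <= Delta)%N.
  case: k k2 lo {hi} => [|[|[|j]]] //= _; first by lia.
  by rewrite /= !expnS expn0 muln1; nia.
(* [s] is the largest group size with hub degree [2s + 1 <= Delta]; [r] pads the centre to degree
   [Delta]. *)
pose s := (Delta.-1)./2; pose r := (Delta - k * k)%N.
have Dr : (k * k + r = Delta)%N by rewrite /r subnKC.
have s2 : (Delta <= s.*2 + 2)%N by rewrite /s; lia.
have s1 : ((s.*2).+1 <= Delta)%N by rewrite /s; lia.
have kD : (k <= Delta)%N by nia.
have cE : #|hub_graph k s r| = (Delta + k * s).+1.
  by rewrite card_hub_graph Dr.
apply: le_trans (@excess_ge (hub_graph k s r) Delta k _ _ _ _ _ _); first last.
- by apply: leq_trans (card_edges_hub_graph _ _ _) _; rewrite Dr cE; nia.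
- exact: tau_D_hub_graph.
- by rewrite cE.
- by rewrite max_degree_hub_graph Dr.
- exact: hub_graph_connected.
- by lia.
rewrite cE; apply: lerB => //.
(* The order is at least [k * Delta / 2]: rounding in [s] costs [k * s] at most [k], which the
   [Delta] neighbours of the centre make up for. *)
have -> : 4 / (k%:R * Delta%:R) = 2 / ((k * Delta)%:R / 2) :> R.
  by rewrite natrM; field; rewrite !pnatr_eq0; lia.
apply: ler_wpM2l => //; rewrite lef_pV2 ?posrE ?divr_gt0 ?ltr0n ?muln_gt0 //; try lia.
rewrite ler_pdivrMr // -natrM ler_nat.
nia.
Qed.

Lemma cube_root_ceil (n : nat) :
  exists k : nat, (0 < n -> k.-1 ^ 3 < n <= k ^ 3)%N.
Proof.
have ex : exists k, (n <= k ^ 3)%N.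
  by exists n; case: n => // n; rewrite expnS leq_pmulr // expn_gt0.
exists (ex_minn ex) => n0; case: ex_minnP => k nk kmin; rewrite nk andbT.
case: k nk kmin => [|k] /=; first by rewrite exp0n; lia.
by move=> _ kmin; rewrite ltnNge; apply/negP => /kmin; rewrite ltnn.
Qed.

Lemma c_sup_ge (Delta : nat) : (8 <= Delta)%N ->
  1 / Delta%:R - 6 * (Delta%:R `^ (- (4 / 3))) <= c_sup R Delta.
Proof.
move=> D8; have [k /(_ (leq_trans (isT : (0 < 8)%N) D8)) hk] := cube_root_ceil Delta.
apply: le_trans (c_sup_ge_cube_root D8 hk).
have D0 : 0 < Delta%:R :> R by rewrite ltr0n; lia.
set t : R := Delta%:R `^ (1 / 3).
have t0 : 0 < t by exact: powR_gt0.
have t3 : t ^+ 3 = Delta%:R.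
  by rewrite -powR_mulrn ?powR_ge0 // -powRrM (_ : 1 / 3 * 3%:R = 1) ?powRr1 ?ltW //; field.
have t4 : Delta%:R `^ (- (4 / 3)) = (t ^+ 4)^-1.
  rewrite powRN; congr (_^-1).
  by rewrite -powR_mulrn ?powR_ge0 // -powRrM; congr (_ `^ _); field.
have t2 : 2 <= t.
  rewrite leNgt; apply/negP => t2.
  have : t ^+ 3 < 2 ^+ 3 by apply: ltrXn2r => //; exact: ltW.
  by rewrite t3 -natrX ltr_nat; lia.
case/andP: hk => lo hi.
have k1 : (1 <= k)%N by case: k hi {lo} => //; rewrite exp0n; lia.
have tk : t <= k%:R.
  rewrite -(@ler_pXn2r _ 3) ?nnegrE ?ler0n ?(ltW t0) //.
  by rewrite t3 -natrX ler_nat.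
have kt : k%:R <= t + 1.
  rewrite -(subnK k1) natrD lerD2r leNgt; apply/negP => kt.
  have : t ^+ 3 < (k - 1)%:R ^+ 3 by apply: ltrXn2r => //; exact: ltW.
  by rewrite t3 -natrX ltr_nat subn1; lia.
rewrite t4 -t3 -addrA -opprD lerD2l lerN2.
(* The first term uses [k <= t + 1 <= t ^+ 2], valid as [t >= 2]; the second uses [t <= k]. *)
have -> : 6 * (t ^+ 4)^-1 = 2 * t ^+ 2 / (t ^+ 3) ^+ 2 + 4 / (t * t ^+ 3).
  by field; rewrite gt_eqF.
have k0 : 0 < k%:R :> R by rewrite ltr0n.
apply: lerD.
  rewrite ler_pM2r ?invr_gt0 ?exprn_gt0 //; nra.
rewrite ler_pM2l // lef_pV2 ?posrE ?mulr_gt0 ?exprn_gt0 //.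
by rewrite ler_pM2r // exprn_gt0.
Qed.

Lemma c_sup_le (Delta : nat) :
  c_sup R Delta <= (Delta%:R + 1) / (Delta%:R ^+ 2 + 1).
Proof.
rewrite /c_sup.
(* On the empty set [sup] is 0, and the bound is nonnegative. *)
have [->|E0] := eqVneq (excess_set R Delta) set0.
  by rewrite sup0 divr_ge0 // addr_ge0 // exprn_ge0.
by apply: ge_sup; [exact/set0P | exact: excess_set_ub].
Qed.

Lemma cvg_natr_powRN (a : R) : 0 < a -> (n%:R `^ (- a) : R) @[n --> \oo] --> 0.
Proof.
move=> a0; apply/cvgrPdist_le => e e0; near=> n.
rewrite sub0r normrN ger0_norm ?powR_ge0 //.
(* This threshold is the solution of [n^(-a) = e]. *)
have hn : (e^-1) `^ a^-1 <= n%:R by near: n; exact: nbhs_infty_ger.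
have n0 : 0 < n%:R :> R by apply: lt_le_trans hn; rewrite powR_gt0 ?invr_gt0.
rewrite powRN invf_ple ?posrE ?powR_gt0 //.
have e'0 : 0 <= e^-1 by rewrite invr_ge0 ltW.
rewrite -[X in X <= _](powRr1 e'0).
rewrite -[X in _ `^ X](mulVf (lt0r_neq0 a0)) powRrM.
by apply: ge0_ler_powR hn; rewrite ?nnegrE ?powR_ge0 ?ltW.
Unshelve. all: by end_near. Qed.

(** Squeeze: multiplying the two bounds by [n] gives [1 - 6 n^(-1/3)] from below and
    [n (n + 1) / (n^2 + 1) <= 1 + 1/n] from above. *)
Lemma mul_c_sup_cvg1 : Delta%:R * c_sup R Delta @[Delta --> \oo] --> (1 : R).
Proof.
apply: (@squeeze_cvgr _ _ _ _ (fun n : nat => 1 - 6 * (n%:R `^ (- (1 / 3))))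
                              (fun n : nat => 1 + n%:R `^ (- 1))); last 2 first.
- rewrite -[X in _ --> X](_ : 1 - 6 * 0 = 1 :> R); last by rewrite mulr0 subr0.
  by apply: cvgB; [exact: cvg_cst | apply: cvgMr; exact: cvg_natr_powRN].
- rewrite -[X in _ --> X](addr0 1).
  by apply: cvgD; [exact: cvg_cst | exact: cvg_natr_powRN].
near=> n.
have n8 : (8 <= n)%N by near: n; exact: nbhs_infty_ge.
have n0 : 0 < n%:R :> R by rewrite ltr0n; lia.
apply/andP; split.
  apply: le_trans (ler_wpM2l (ltW n0) (c_sup_ge n8)).
  have -> : - (4 / 3) = - 1 + - (1 / 3) :> R by field.
  rewrite powRD; last by rewrite (gt_eqF n0) implybT.
  rewrite powR_inv1 ?(ltW n0) // mulrBr (div1r n%:R) mulfV ?gt_eqF //.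
  by rewrite (mulrCA n%:R) mulVKf ?gt_eqF.
apply: le_trans (ler_wpM2l (ltW n0) (c_sup_le n)) _.
rewrite powR_inv1 ?(ltW n0) // mulrA ler_pdivrMr; last by nra.
set x : R := n%:R in n0 *.
have -> : (1 + x^-1) * (x ^+ 2 + 1) = x * (x + 1) + (1 + x^-1) by field; rewrite gt_eqF.
by rewrite lerDl addr_ge0 // invr_ge0 ltW.
Unshelve. all: by end_near. Qed.

End Bounds.

Theorem theorem5p4 (R : realType) :
  (forall Delta : nat, (8 <= Delta)%N ->
     1 / Delta%:R - 6 * (Delta%:R `^ (- (4 / 3))) <= c_sup R Delta) /\
  (Delta%:R * c_sup R Delta @[Delta --> \oo] --> (1 : R)).
Proof. by split; [exact: c_sup_ge | exact: mul_c_sup_cvg1]. Qed.
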